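(* Let $S$ be a semigroup. The following are equivalent: (1) $S$ is weakly right noetherian; (2) $S$ satisfies the ascending chain condition on principal right ideals and contains no infinite antichain of principal right ideals (under $\subseteq$); (3) the poset of $\mathcal{R}$-classes of $S$ contains no infinite strictly ascending chain and no infinite antichain.
   Context: For $X\subseteq S$ write $XS^1=X\cup XS$ (where $S^1$ is $S$ with an identity adjoined if necessary), and $aS^1=\{a\}S^1$. A right ideal of $S$ is a subset $I\subseteq S$ with $IS\subseteq I$; it is finitely generated if $I=XS^1$ for some finite $X\subseteq I$. A semigroup is weakly right noetherian if every right ideal of it is finitely generated. A principal right ideal is one of the form $aS^1$, $a\in S$. Green's relation $\mathcal{R}$ on $S$ is defined by $a\,\mathcal{R}\,b\iff aS^1=bS^1$; the set of $\mathcal{R}$-classes is partially ordered by $R_a\leq R_b\iff aS^1\subseteq bS^1$, where $R_a$ is the $\mathcal{R}$-class of $a$. An antichain is a set of pairwise incomparable elements of a poset. *)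

(* Defs.v *)
From HB Require Import structures.
From mathcomp Require Import all_boot all_order.
From mathcomp Require Import boolp classical_sets cardinality.

Set Implicit Arguments.
Unset Strict Implicit.
Unset Printing Implicit Defensive.

Local Open Scope classical_set_scope.
Local Open Scope group_scope.

Definition antichain d (T : porderType d) (A : set T) : Prop :=
  forall x y : T, A x -> A y -> x <> y -> (x >< y)%O.

Definition no_infinite_antichain_in d (T : porderType d) (P : set T) : Prop :=
  forall A : set T, A `<=` P -> antichain A -> finite_set A.

Definition no_infinite_ascending_chain d (T : porderType d) : Prop :=
  ~ exists u : nat -> T, forall n, (u n < u n.+1)%O.

Section RightIdeals.
Variable S : semigroupType.
Implicit Types (a b : S) (X I : set S).

(* X S^1; as in X S^1 = X \cup X S, no identity element needs to be adjoined *)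
Definition mulS1 X : set S := X `|` [set x * s | x in X & s in [set: S]].

Definition right_ideal I : Prop := forall x s, I x -> I (x * s).

Definition fin_gen_right_ideal I : Prop :=
  exists X, [/\ finite_set X, X `<=` I & I = mulS1 X].

Definition weakly_right_noetherian : Prop :=
  forall I, right_ideal I -> fin_gen_right_ideal I.

(* as elements of set S these are ordered by inclusion, see subsetEset *)
Definition principal_right_ideals : set (set S) :=
  [set mulS1 [set a] | a in [set: S]].

Definition acc_principal_right_ideals : Prop :=
  forall I : nat -> set S,
    (forall n, principal_right_ideals (I n)) ->
    (forall n, I n `<=` I n.+1) ->
    exists N, forall n, (N <= n)%N -> I n = I N.

Definition greenR a b : Prop := mulS1 [set a] = mulS1 [set b].

Definition Rclass a : set S := [set b | greenR a b].

Definition is_Rclass (C : set S) : bool := `[< exists a, C = Rclass a >].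

End RightIdeals.

Arguments principal_right_ideals S : clear implicits.

Record Rclasses (S : semigroupType) :=
  MkRclasses { Rclass_set :> set S; Rclass_setP : is_Rclass Rclass_set }.

HB.instance Definition _ S := [isSub for @Rclass_set S].
HB.instance Definition _ S := [Choice of Rclasses S by <:].

Section RclassesOrder.
Variable S : semigroupType.
Implicit Types C D E : Rclasses S.

Definition Rclasses_le C D : bool :=
  `[< exists a b : S, [/\ C = Rclass a :> set S, D = Rclass b :> set S &
      mulS1 [set a] `<=` mulS1 [set b]] >].

Lemma Rclass_inj (a b : S) :
  Rclass a = Rclass b -> mulS1 [set a] = mulS1 [set b].
Proof. by move=> ab; have : Rclass a b by rewrite ab. Qed.

Fact Rclasses_le_refl : reflexive Rclasses_le.
Proof.
move=> C; have /asboolP[a Ca] := Rclass_setP C.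
by apply/asboolP; exists a, a; split.
Qed.

Fact Rclasses_le_anti : antisymmetric Rclasses_le.
Proof.
move=> C D /andP[/asboolP[a [b [Ca Db ab]]] /asboolP[b' [a' [Db' Ca' ba]]]].
apply: val_inj => /=; rewrite Ca Db /Rclass.
have eaa' : mulS1 [set a] = mulS1 [set a'] by apply: Rclass_inj; rewrite -Ca.
have ebb' : mulS1 [set b] = mulS1 [set b'] by apply: Rclass_inj; rewrite -Db.
rewrite /greenR; suff -> : mulS1 [set a] = mulS1 [set b] by [].
by apply/seteqP; split=> //; rewrite eaa' ebb'.
Qed.

Fact Rclasses_le_trans : transitive Rclasses_le.
Proof.
move=> D C E /asboolP[a [b [Ca Db ab]]] /asboolP[b' [c [Db' Ec bc]]].
apply/asboolP; exists a, c; split=> //; apply: subset_trans ab _.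
by rewrite (_ : mulS1 [set b] = mulS1 [set b'])//; apply: Rclass_inj; rewrite -Db.
Qed.

End RclassesOrder.

Fact Rclasses_display : Order.disp_t. Proof. exact: Order.Disp tt tt. Qed.

HB.instance Definition _ S :=
  Order.Le_isPOrder.Build Rclasses_display (Rclasses S)
    (@Rclasses_le_refl S) (@Rclasses_le_anti S) (@Rclasses_le_trans S).

(* Main.v *)
(** In a right noetherian semigroup the union of an ascending chain of right
    ideals is finitely generated, so it is reached at a finite stage; and for an
    antichain [A] of principal right ideals, finitely many members of [A]
    contain generators of the union of [A], hence every member of [A] lies in,
    and so equals, one of them.  Conversely, by the ascending chain condition
    every R-class inside a right ideal [I] lies below a maximal one; the maximal
    ones form an antichain, and representatives of them generate [I]. *)
Require Import Defs.
From mathcomp Require Import all_boot all_order.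
From mathcomp Require Import boolp classical_sets cardinality.

Set Implicit Arguments.
Unset Strict Implicit.
Unset Printing Implicit Defensive.

Import Order.Theory.
Local Open Scope classical_set_scope.
Local Open Scope group_scope.

Definition maximal_in d (T : porderType d) (P : set T) : set T :=
  [set y | P y /\ forall z, P z -> (y <= z)%O -> z = y].

Lemma antichain_maximal_in d (T : porderType d) (P : set T) :
  antichain (maximal_in P).
Proof.
move=> x y [Px maxx] [Py maxy] xy; rewrite /Order.comparable.
apply/norP; split; apply/negP; last by move/(maxy _ Px)/xy.
by move/(maxx _ Py)/esym/xy.
Qed.

(** If no maximal element of [P] lay above [x], every element of [P] above [x] would have a strictly
    larger one in [P], and dependent choice would build an infinite ascending chain. *)
Lemma ex_maximal_in d (T : porderType d) (P : set T) x :
  no_infinite_ascending_chain T -> P x ->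
  exists2 y, maximal_in P y & (x <= y)%O.
Proof.
move=> noasc Px; apply: contrapT => nomax; apply: noasc.
pose U := {y : T | P y /\ (x <= y)%O}.
have step (y : U) : {z : U | (sval y < sval z)%O}.
  apply: cid; case: y => y [Py xy] /=; apply: contrapT => nolt.
  apply: nomax; exists y => //; split=> // z Pz yz.
  apply: contrapT => /eqP zy; apply: nolt.
  by exists (exist _ z (conj Pz (le_trans xy yz))); rewrite /= lt_neqAle eq_sym zy.
have [u [_ u_lt]] := dependent_choice step (exist _ x (conj Px (lexx x))).
by exists (sval \o u).
Qed.

Section RightIdealTheory.
Variable S : semigroupType.
Implicit Types (a b : S) (X I : set S) (C D : Rclasses S).

Lemma sub_mulS1 X : X `<=` mulS1 X.
Proof. by move=> x Xx; left. Qed.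

Lemma right_ideal_mulS1 X : right_ideal (mulS1 X).
Proof.
move=> y s [Xy|[x Xx [t _ <-]]]; right; first by exists y => //; exists s.
by exists x => //; exists (t * s) => //; rewrite mulgA.
Qed.

Lemma mulS1_sub X I : right_ideal I -> X `<=` I -> mulS1 X `<=` I.
Proof.
by move=> idI XI y [/XI //|[x Xx [s _ <-]]]; apply: idI; apply: XI.
Qed.

Lemma mulS1_bigcup X y : mulS1 X y -> exists2 x, X x & mulS1 [set x] y.
Proof.
move=> [Xy|[x Xx [s _ <-]]]; first by exists y => //; left.
by exists x => //; right; exists x => //; exists s.
Qed.

Lemma mem_mulS11 a : mulS1 [set a] a.
Proof. exact: sub_mulS1. Qed.

Lemma right_ideal_bigcup (A : set (set S)) :
  (forall I, A I -> right_ideal I) -> right_ideal (\bigcup_(I in A) I).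
Proof. by move=> idA x s [I AI Ix]; exists I => //; apply: idA. Qed.

Lemma right_ideal_principal I : principal_right_ideals S I -> right_ideal I.
Proof. by move=> [a _ <-]; apply: right_ideal_mulS1. Qed.

Lemma weakly_right_noetherian_acc :
  weakly_right_noetherian S -> acc_principal_right_ideals S.
Proof.
move=> noeth I prI sI.
have leI m n : (m <= n)%N -> I m `<=` I n.
  move=> /subnK <-; elim: (n - m)%N => // k IHk.
  by rewrite addSn; apply: subset_trans (sI _).
have [x s [J [n _ <-]] Jx|X [/finite_seqP[s ->] XU eqU]] :=
    noeth (\bigcup_(J in range I) J).
  by exists (I n) => //; apply: right_ideal_principal (prI n) _ _ Jx.
(* Each generator lies in some [I m]; as the chain is monotone, the largest such stage contains them
   all. *)
have [N sN] : exists N, [set` s] `<=` I N.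
  elim: s XU {eqU} => [|x s IHs] XU; first by exists 0.
  have [|N sN] := IHs; first by move=> y ys; apply: XU; rewrite /= inE ys orbT.
  have [|_ [m _ <-] Imx] := XU x; first by rewrite /= inE eqxx.
  exists (maxn m N) => y; rewrite /= inE => /orP[/eqP ->|ys].
    exact: leI (leq_maxl _ _) _ Imx.
  exact: leI (leq_maxr _ _) _ (sN _ ys).
exists N => n Nn; apply/seteqP; split; last exact: leI.
move=> y Iny; apply: (mulS1_sub (right_ideal_principal (prI N)) sN).
by rewrite -eqU; exists (I n) => //; exists n.
Qed.

Lemma weakly_right_noetherian_antichain :
  weakly_right_noetherian S ->
  no_infinite_antichain_in (principal_right_ideals S).
Proof.
move=> noeth A prA antiA.
have idA J : A J -> right_ideal J by move=> /prA /right_ideal_principal.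
have [X [finX XU eqU]] := noeth _ (right_ideal_bigcup idA).
(* The implication sits under the existential so that [choice] yields a total function; [setT] is a
   dummy value outside [X]. *)
have coverX x : exists J, X x -> A J /\ J x.
  have [/XU [J AJ Jx]|nXx] := pselect (X x); first by exists J.
  by exists setT => /nXx.
have [K KP] := choice coverX.
apply: sub_finite_set (finite_image K finX) => J AJ.
have [a _ Ja] := prA _ AJ.
(* The generator [a] of [J] lies in the ideal of some [x] in [X], hence in [K x]. So [J] is included
   in [K x], and incomparability in [A] forces [K x = J]. *)
have [x Xx xa] : exists2 x, X x & mulS1 [set x] a.
  apply: (@mulS1_bigcup X); rewrite -eqU; exists J => //.
  by rewrite -Ja; apply: mem_mulS11.
have [AK Kx] := KP x Xx; exists x => //; apply: contrapT => KJ.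
have /negP := antiA _ _ AK AJ KJ; apply.
rewrite /Order.comparable; apply/orP; right; rewrite subsetEset -Ja.
apply: mulS1_sub (idA _ AK) _ => _ ->.
by apply: (mulS1_sub (idA _ AK) _ xa) => _ ->.
Qed.

(** R-related elements generate the same right ideal, so [mulS1] sends an R-class to its principal
    right ideal without choosing a representative. *)
Lemma mulS1_Rclass a : mulS1 (Rclass a) = mulS1 [set a].
Proof.
apply/seteqP; split; apply: mulS1_sub; try exact: right_ideal_mulS1.
  by move=> b ab; rewrite ab; apply: mem_mulS11.
by move=> _ ->; apply: sub_mulS1.
Qed.

Lemma Rclass_repr C : exists a, C = Rclass a :> set S.
Proof. exact/asboolP/Rclass_setP. Qed.

Lemma principal_mulS1_Rclass C : principal_right_ideals S (mulS1 C).
Proof. by have [a ->] := Rclass_repr C; exists a; rewrite ?mulS1_Rclass. Qed.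

(** This makes [mulS1] an order embedding of the R-classes into the principal right ideals, along
    which chains and antichains are transported. *)
Lemma Rclasses_leE C D : (C <= D)%O = (mulS1 C `<=` mulS1 D) :> Prop.
Proof.
apply/propext; split.
  by move=> /asboolP[a [b [-> -> ab]]]; rewrite !mulS1_Rclass.
have [[a Ca] [b Db]] := (Rclass_repr C, Rclass_repr D).
by rewrite Ca Db !mulS1_Rclass => ab; apply/asboolP; exists a, b.
Qed.

Lemma mulS1_Rclasses_inj : injective (fun C => mulS1 C).
Proof. by move=> C D /= CD; apply/le_anti/andP; split; rewrite Rclasses_leE CD. Qed.

Lemma acc_Rclasses :
  acc_principal_right_ideals S -> no_infinite_ascending_chain (Rclasses S).
Proof.
move=> acc [u u_lt].
have [|n|N uN] := acc (fun n => mulS1 (u n)).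
- by move=> n; apply: principal_mulS1_Rclass.
- by rewrite -Rclasses_leE; apply: ltW.
have /mulS1_Rclasses_inj uNE := uN N.+1 (leqnSn N).
by have := u_lt N; rewrite uNE ltxx.
Qed.

Lemma antichain_Rclasses :
  no_infinite_antichain_in (principal_right_ideals S) ->
  no_infinite_antichain_in [set: Rclasses S].
Proof.
move=> noanti A _ antiA.
have injA : {in A &, injective (fun C => mulS1 C)}.
  by move=> C D _ _; apply: mulS1_Rclasses_inj.
(* By injectivity [A] is finite as soon as its image is, and that image is an antichain of principal
   right ideals. *)
rewrite -(eq_finite_set (inj_card_eq injA)).
apply: noanti => [_ [C _ <-]|_ _ [C AC <-] [D AD <-] CD].
  exact: principal_mulS1_Rclass.
have : (C >< D)%O by apply: antiA => // eCD; apply: CD; rewrite eCD.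
apply: contraNN; rewrite /Order.comparable => /orP[] le_;
  apply/orP; [left|right]; by rewrite Rclasses_leE -subsetEset.
Qed.

Lemma Rclasses_weakly_right_noetherian :
  no_infinite_ascending_chain (Rclasses S) ->
  no_infinite_antichain_in [set: Rclasses S] -> weakly_right_noetherian S.
Proof.
move=> noasc noanti I idI.
(* Maximality is only among the R-classes contained in [I]; larger classes may exist outside [I]. *)
pose M := maximal_in [set C : Rclasses S | C `<=` I].
have finM : finite_set M by apply: noanti => //; apply: antichain_maximal_in.
have [r rE] := choice Rclass_repr.
have XI : r @` M `<=` I by move=> _ [C [CI _] <-]; apply: CI; rewrite rE.
exists (r @` M); split=> //; first exact: finite_image.
apply/seteqP; split; last exact: mulS1_sub.
move=> a Ia.
have aP : is_Rclass (Rclass a) by apply/asboolP; exists a.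
have aI : Rclass a `<=` I.
  move=> b ab; have : mulS1 [set a] b by rewrite ab; apply: mem_mulS11.
  by apply: mulS1_sub => // _ ->.
have [D MD] := ex_maximal_in noasc (aI : [set C : Rclasses S | C `<=` I]
  (MkRclasses aP)).
(* Since the class of [a] is below [D], [a] lies in the right ideal generated by the representative
   [r D]. *)
rewrite Rclasses_leE (rE D) !mulS1_Rclass => /(_ _ (mem_mulS11 a)).
apply: mulS1_sub; first exact: right_ideal_mulS1.
by move=> _ ->; apply: sub_mulS1; exists D.
Qed.

End RightIdealTheory.

Theorem theorem3p2 (S : semigroupType) :
  [<-> weakly_right_noetherian S;
       acc_principal_right_ideals S /\
         no_infinite_antichain_in (principal_right_ideals S);
       no_infinite_ascending_chain (Rclasses S) /\
         no_infinite_antichain_in [set: Rclasses S]%classic].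
Proof.
tfae=> [noeth|[acc noanti]|[noasc noanti]].
- split; first exact: weakly_right_noetherian_acc.
  exact: weakly_right_noetherian_antichain.
- by split; [apply: acc_Rclasses|apply: antichain_Rclasses].
- exact: Rclasses_weakly_right_noetherian.
Qed.
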